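(* Let $\Lambda=\{\lambda_1,\dots,\lambda_{|\Lambda|}\}\subset[0,1]$ be any finite set (a finite discretisation of the parameter $\lambda$). Then one can construct an infinite family $\mathcal{F}$ of (pairwise distinct) MILP instances, together with an infinite set $\mathcal{C}$ of family-wide valid cuts, such that, when the pure cutting plane approach with scoring parameter $\lambda$, applying a single cut per selection round, is run with candidate cuts drawn from $\mathcal{C}$: (i) for every $\lambda\in\Lambda$, no instance in $\mathcal{F}$ is solved to optimality; (ii) every instance in $\mathcal{F}$ is solved to optimality for infinitely many values $\lambda\in[0,1]\setminus\Lambda$.
   Context: A MILP instance is $\min\{\mathbf{c}^{\top}\mathbf{x} : A\mathbf{x}\le \mathbf{b},\ \mathbf{l}\le\mathbf{x}\le\mathbf{u},\ x_i\in\mathbb{Z}\ \text{for } i\in\mathcal{J}\}$ with $\mathbf{c}\in\mathbb{R}^n$ and $\mathcal{J}\subseteq\{1,\dots,n\}$ the index set of integer variables; instances are understood to possess an optimal solution. Its LP relaxation drops the integrality requirements. A (linear) cut is a vector $\boldsymbol{\alpha}=(\alpha_0,\dots,\alpha_n)\in\mathbb{R}^{n+1}$ representing the inequality $\sum_{i=1}^n\alpha_i x_i\le\alpha_0$; it is valid for an instance if every feasible solution of the MILP satisfies it, and it is family-wide valid for a family of instances if it is valid for every member of the family. Cut measures: the integer support is $\mathrm{isp}(\boldsymbol{\alpha})=\dfrac{|\{i\in\mathcal{J}:\alpha_i\neq0\}|}{|\{i\in\{1,\dots,n\}:\alpha_i\ne0\}|}$, and the objective parallelism is $\mathrm{obp}(\boldsymbol{\alpha},\mathbf{c})=\left|\dfrac{\sum_{i=1}^n\alpha_ic_i}{\sqrt{\sum_{i=1}^n\alpha_i^2}\sqrt{\sum_{i=1}^nc_i^2}}\right|$.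 For $\lambda\in[0,1]$ the score of a cut is $\lambda\,\mathrm{isp}(\boldsymbol{\alpha})+(1-\lambda)\,\mathrm{obp}(\boldsymbol{\alpha},\mathbf{c})$. Pure cutting plane approach with parameter $\lambda$, one cut per round: starting from the LP relaxation, compute an LP-optimal vertex $\mathbf{x}^{LP}$ (the LP solver being a fixed, arbitrary selection among optimal vertices). If $\mathbf{x}^{LP}$ satisfies the integrality requirements, stop: the instance is solved to optimality. Otherwise a nonempty finite set of candidate cuts from $\mathcal{C}$, each violated by $\mathbf{x}^{LP}$, is presented (which candidates are presented may depend on the cuts added so far and is part of the construction); exactly one candidate with highest score is added to the LP (ties are broken by a fixed priority rule on cuts, also part of the construction), and the process repeats with the new LP. The instance is not solved to optimality if this process never stops, i.e. no LP solution in the infinite sequence of rounds satisfies the integrality requirements. *)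

(* Defs.v *)
From HB Require Import structures.
From mathcomp Require Import all_boot all_order all_algebra.
From mathcomp Require Import finmap.
From mathcomp Require Import all_classical all_reals.

Set Implicit Arguments.
Unset Strict Implicit.
Unset Printing Implicit Defensive.

Import Order.TTheory GRing.Theory Num.Theory.
Local Open Scope ring_scope.

(* A cut is (alpha_0, ..., alpha_n), standing for
   alpha_1 x_1 + ... + alpha_n x_n <= alpha_0.  The variable x_(i+1) has index
   i : 'I_n, so its coefficient is the entry of index [lift ord0 i]. *)
Notation cut R n := 'rV[R]_n.+1.

Section Cuts.
Variables (R : realType) (n : nat).
Implicit Types (alpha : cut R n) (x : 'cV[R]_n).

Definition cut_rhs alpha : R := alpha 0 ord0.
Definition cut_coef alpha (i : 'I_n) : R := alpha 0 (lift ord0 i).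

Definition satisfies x alpha : Prop :=
  \sum_(i < n) cut_coef alpha i * x i 0 <= cut_rhs alpha.

Definition violates x alpha : Prop := ~ satisfies x alpha.

End Cuts.

(* min c^T x subject to A x <= b and l <= x <= u. *)
Record lp (R : realType) (n : nat) := Lp {
  lp_rows : nat;
  lp_mx : 'M[R]_(lp_rows, n);
  lp_rhs : 'cV[R]_lp_rows;
  lp_lower : 'cV[\bar R]_n;
  lp_upper : 'cV[\bar R]_n;
  lp_obj : 'cV[R]_n
}.

Record milp (R : realType) (n : nat) := Milp {
  relaxation : lp R n;
  int_vars : {set 'I_n}
}.

Section Milp.
Variables (R : realType) (n : nat).
Implicit Types (L : lp R n) (P : milp R n) (x y : 'cV[R]_n) (alpha : cut R n).

Definition lp_feasible L x : Prop :=
  (forall k, (lp_mx L *m x) k 0 <= lp_rhs L k 0) /\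
  (forall i, (lp_lower L i 0%R <= (x i 0%R)%:E <= lp_upper L i 0%R)%E).

Definition lp_value L x : R := \sum_(i < n) lp_obj L i 0 * x i 0.

Definition lp_optimal L x : Prop :=
  lp_feasible L x /\ forall y, lp_feasible L y -> lp_value L x <= lp_value L y.

(* x is an extreme point of the feasible polyhedron. *)
Definition lp_vertex L x : Prop :=
  lp_feasible L x /\
  forall y z (t : R), lp_feasible L y -> lp_feasible L z -> 0 < t < 1 ->
    x = t *: y + (1 - t) *: z -> y = z.

Definition optimal_vertex L x : Prop := lp_optimal L x /\ lp_vertex L x.

Definition add_cut L alpha : lp R n :=
  Lp (col_mx (lp_mx L) (\row_(i < n) cut_coef alpha i))
     (col_mx (lp_rhs L) (cut_rhs alpha)%:M)
     (lp_lower L) (lp_upper L) (lp_obj L).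

Definition integral P x : Prop :=
  forall i, i \in int_vars P -> x i 0 \is a Num.int.

Definition milp_feasible P x : Prop :=
  lp_feasible (relaxation P) x /\ integral P x.

Definition has_optimal_solution P : Prop :=
  exists2 x, milp_feasible P x &
    forall y, milp_feasible P y ->
      lp_value (relaxation P) x <= lp_value (relaxation P) y.

Definition valid_cut P alpha : Prop :=
  forall x, milp_feasible P x -> satisfies x alpha.

Definition family_valid (F : set (milp R n)) alpha : Prop :=
  forall P, F P -> valid_cut P alpha.

End Milp.

Section Scores.
Variables (R : realType) (n : nat).
Implicit Types (P : milp R n) (alpha : cut R n) (c : 'cV[R]_n).

(* The denominator is positive for every violated valid cut of a feasible
   instance, as such a cut has a nonzero coefficient. *)
Definition isp (J : {set 'I_n}) alpha : R :=
  #|[pred i in J | cut_coef alpha i != 0]|%:R /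
  #|[pred i : 'I_n | cut_coef alpha i != 0]|%:R.

Definition obp alpha c : R :=
  `| (\sum_(i < n) cut_coef alpha i * c i 0) /
     (Num.sqrt (\sum_(i < n) cut_coef alpha i ^+ 2) *
      Num.sqrt (\sum_(i < n) c i 0 ^+ 2)) |.

Definition score P (lambda : R) alpha : R :=
  lambda * isp (int_vars P) alpha +
  (1 - lambda) * obp alpha (lp_obj (relaxation P)).

End Scores.

Section CuttingPlane.
Variables (R : realType) (n : nat).

Definition lp_solver := lp R n -> 'cV[R]_n.

Definition selects_optimal_vertex (solve : lp_solver) : Prop :=
  forall L, (exists x, optimal_vertex L x) -> optimal_vertex L (solve L).

(* The candidates presented for an instance, given the cuts added so far
   (oldest first).  Since lambda is not an argument, it can influence the
   candidates only through the cuts it has caused to be added. *)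
Definition presentation := milp R n -> seq (cut R n) -> {fset cut R n}.

(* [prio alpha beta]: alpha is preferred to beta when their scores are equal. *)
Definition priority_rule (prio : rel (cut R n)) : Prop :=
  [/\ total prio, antisymmetric prio & transitive prio].

Variables (cand : presentation) (prio : rel (cut R n)) (solve : lp_solver).
Implicit Types (P : milp R n) (lambda : R) (H : seq (cut R n)).

Definition lp_after P H : lp R n := foldl (@add_cut R n) (relaxation P) H.

Definition lp_point P H : 'cV[R]_n := solve (lp_after P H).

Definition selected P lambda H (alpha : cut R n) : Prop :=
  alpha \in cand P H /\
  forall beta, beta \in cand P H ->
    score P lambda beta < score P lambda alpha \/
    (score P lambda beta = score P lambda alpha /\ prio alpha beta).

(* The sequences of added cuts that occur at some round of the approach. *)
Inductive reachable P lambda : seq (cut R n) -> Prop :=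
| reachable_start : reachable P lambda [::]
| reachable_round H alpha :
    reachable P lambda H -> ~ integral P (lp_point P H) ->
    selected P lambda H alpha -> reachable P lambda (rcons H alpha).

(* Every round can be carried out: the LP has an optimal vertex, and unless it
   is integral the presented candidates are as required. *)
Definition well_defined_run (C : set (cut R n)) P lambda : Prop :=
  forall H, reachable P lambda H ->
    optimal_vertex (lp_after P H) (lp_point P H) /\
    (~ integral P (lp_point P H) ->
       (exists alpha, alpha \in cand P H) /\
       (forall alpha, alpha \in cand P H ->
          C alpha /\ violates (lp_point P H) alpha)).

Definition solved_to_optimality P lambda : Prop :=
  exists2 H, reachable P lambda H & integral P (lp_point P H).

Definition never_stops P lambda : Prop :=
  exists a : nat -> cut R n, forall k,
    reachable P lambda (mkseq a k) /\ ~ integral P (lp_point P (mkseq a k)).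

End CuttingPlane.

(* Main.v *)
Require Import Defs.
From mathcomp Require Import all_boot all_order all_algebra.
From mathcomp Require Import finmap.
From mathcomp Require Import all_classical all_reals.
From mathcomp Require Import ring lra.
Local Open Scope ring_scope.
Local Open Scope classical_set_scope.

Import Order.TTheory GRing.Theory Num.Theory.

(** The instances have three variables: an integer one with bounds
    -t <= x_0 <= 1/2, where t is a natural number that distinguishes the
    members of the family, and x_1 (continuous) and x_2 (integer), both fixed
    at 0 by their bounds.  The objective is to minimise - x_0.  All cuts have a
    positive coefficient on x_0, so the polyhedron of every round is a segment
    -t <= x_0 <= u of the first axis, and its unique optimal vertex is the
    right endpoint ([segment_optimal_vertex], [segment_add_cut]).  Hence the
    solver has no choice.  After k rounds u is either 1/(k+2), and the vertex
    is fractional, or 0, and the instance is solved ([reachable_segment]).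

    As x_1 = x_2 = 0, the coefficients of a cut on these variables do not
    change what it cuts off, only its score.  All normals have norm 1, so the
    objective parallelism of a cut is its coefficient on x_0.  The round that
    follows k earlier ones has three candidates:
     - the low cut, normal (3/5, 4/5, 0), integer support 1/2, makes
       u = 1/(k+3);
     - the middle cut, normal (3/5, 12/25, 16/25), integer support 2/3, makes
       u = 0;
     - the high cut, normal (q, 0, sqrt (1 - q^2)), integer support 1, makes
       u = 1/(k+3).
    Let d <= 1 be a positive lower bound of the positive elements of Lambda,
    and let q = 3/5 - d/3.  At lambda = 0 the low and middle cuts tie for the
    highest score and the low cut is preferred ([selected_low_cut]).  For
    lambda >= d the integer support outweighs the loss d/3 of parallelism and
    the high cut wins ([selected_high_cut]).  Either way u stays positive
    forever ([run_never_stops]).  But for 0 < lambda < d/3 the middle cut wins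
    ([selected_mid_cut]) and the instance is solved after one round
    ([run_solved]). *)

(** * Infinite and finite sets *)

Lemma infinite_set_inj {T : Type} (A : set T) (f : nat -> T) :
  injective f -> (forall k, A (f k)) -> infinite_set A.
Proof.
move=> f_inj fA /finite_setPn; apply.
have <- : f @^-1` A = [set: nat] by apply/seteqP; split=> // k _; exact: fA.
by apply: card_ge_preimage => i j _ _ /f_inj.
Qed.

Lemma finite_pos_lower_bound (R : realType) (A : set R) : finite_set A ->
  exists2 d, 0 < d <= 1 & forall x, A x -> 0 < x -> d <= x.
Proof.
move=> /finite_seqP[s ->]; elim: s => [|y s [d /andP[d0 d1] dP]].
  by exists 1; rewrite ?ltr01 ?lexx.
case: (ltP 0 y) => y0.
  exists (Order.min d y); first by rewrite lt_min d0 y0 ge_min d1.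
  move=> x /=; rewrite inE => /orP[/eqP ->|xs] x0.
    by rewrite ge_min lexx orbT.
  by rewrite ge_min dP.
exists d; rewrite ?d0//= => x; rewrite inE => /orP[/eqP ->|xs] x0.
  by rewrite ltNge y0 in x0.
exact: dP.
Qed.

(** * Linear programs whose feasible set is a segment of the first axis *)

Section Segment.
Variables (R : realType) (n : nat).
Implicit Types (L : lp R n.+1) (x : 'cV[R]_n.+1) (a s u : R).

(** The point of the first axis with coordinate [s]. *)
Definition axis_point s : 'cV[R]_n.+1 := s *: delta_mx 0 0.

Lemma axis_pointE s i : axis_point s i 0 = s * (i == 0)%:R.
Proof. by rewrite !mxE eqxx andbT. Qed.

Lemma axis_point0 s : axis_point s 0 0 = s.
Proof. by rewrite axis_pointE eqxx mulr1. Qed.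

Lemma lp_valueE L x : lp_obj L = - delta_mx 0 0 -> lp_value L x = - x 0 0.
Proof.
rewrite /lp_value => ->; rewrite big_ord_recl big1 => [|i _].
  by rewrite !mxE eqxx addr0 mulN1r.
by rewrite !mxE /= oppr0 mul0r.
Qed.

(** The objective is to minimise - x_0, and the feasible points are those of the
    first axis between [a] and [u]. *)
Definition segment_lp L a u : Prop :=
  lp_obj L = - delta_mx 0 0 /\
  forall x, lp_feasible L x <-> exists2 s, a <= s <= u & x = axis_point s.

Lemma segment_optimal_vertex {L a u} x : a <= u -> segment_lp L a u ->
  optimal_vertex L x <-> x = axis_point u.
Proof.
move=> le_au [objL feasL].
have feas_u : lp_feasible L (axis_point u).
  by apply/feasL; exists u; rewrite ?lexx ?le_au.
split=> [[[/feasL[s /andP[_ su] ->] opt] _]|->].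
  have := opt _ feas_u; rewrite !lp_valueE// !axis_point0 lerN2 => us.
  by congr axis_point; apply/le_anti/andP.
split; split=> //.
  by move=> y /feasL[s /andP[_ su] ->]; rewrite !lp_valueE// !axis_point0 lerN2.
move=> y z t /feasL[s1 /andP[_ su1] ->] /feasL[s2 /andP[_ su2] ->] /andP[t0 t1].
move=> /matrixP/(_ 0 0).
rewrite [in RHS]mxE [in RHS]mxE [X in _ + X]mxE !axis_point0.
(* u is a proper convex combination of s1 <= u and s2 <= u *)
by move=> e; congr axis_point; nra.
Qed.

(** The cut with normal vector [v] whose hyperplane meets the first axis at
    [axis_point r]. *)
Definition crossing_cut (v : seq R) (r : R) : cut R n.+1 :=
  \row_j (if unlift ord0 j is Some i then v`_i else v`_0 * r).

Lemma crossing_cut_rhs v r : cut_rhs (crossing_cut v r) = v`_0 * r.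
Proof. by rewrite /cut_rhs mxE unlift_none. Qed.

Lemma crossing_cut_coef v r i : cut_coef (crossing_cut v r) i = v`_i.
Proof. by rewrite /cut_coef mxE liftK. Qed.

Lemma crossing_cutP v r s : 0 < v`_0 ->
  satisfies (axis_point s) (crossing_cut v r) <-> s <= r.
Proof.
move=> v0; rewrite /satisfies crossing_cut_rhs big_ord_recl big1 => [|i _].
  by rewrite addr0 crossing_cut_coef axis_point0 ler_pM2l.
by rewrite axis_pointE /= !mulr0.
Qed.

Lemma add_cut_feasible {m} (L : lp R m) alpha y :
  lp_feasible (add_cut L alpha) y <-> lp_feasible L y /\ satisfies y alpha.
Proof.
have rowE : \sum_(i < m) cut_coef alpha i * y i 0 =
    ((\row_i cut_coef alpha i) *m y) 0 0.
  by rewrite mxE; apply: eq_bigr => i _; rewrite mxE.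
have rhsE : cut_rhs alpha = ((cut_rhs alpha)%:M : 'M_1) 0 0.
  by rewrite mxE mulr1n.
rewrite /lp_feasible /satisfies /= rowE [X in _ <= X]rhsE; split.
  move=> [rows bnds]; split; [split=> // k|].
    by have := rows (lshift 1 k); rewrite mul_col_mx !col_mxEu.
  by have := rows (rshift _ 0); rewrite mul_col_mx !col_mxEd.
move=> [[rows bnds] sat]; split=> // k.
rewrite mul_col_mx -[k]splitK; case: (fintype.split k) => j /=.
  by rewrite !col_mxEu.
by rewrite !col_mxEd ord1.
Qed.

Lemma segment_add_cut L a u v r : 0 < v`_0 -> r <= u -> segment_lp L a u ->
  segment_lp (add_cut L (crossing_cut v r)) a r.
Proof.
move=> v0 ru [objL feasL]; split=> // x; rewrite add_cut_feasible feasL.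
split=> [[[s /andP[sa su] ->]]|[s /andP[sa sr] ->]].
  move=> /(crossing_cutP _ _ _ v0) sr.
  by exists s; rewrite ?sa.
by split; [exists s; rewrite // sa (le_trans sr)|exact/crossing_cutP].
Qed.

Lemma obp_crossing_cut v r : 0 <= v`_0 -> \sum_(i < n.+1) v`_i ^+ 2 = 1 ->
  obp (crossing_cut v r) (- delta_mx 0 0) = v`_0.
Proof.
move=> v0 v1; rewrite /obp.
under eq_bigr do rewrite crossing_cut_coef.
under [X in Num.sqrt X * _]eq_bigr do rewrite crossing_cut_coef.
rewrite v1 !big_ord_recl !big1 => [|i _|i _].
- rewrite !mxE eqxx mulr1n sqrrN expr1n !addr0 sqrtr1 mulr1 divr1 mulrN mulr1.
  by rewrite normrN ger0_norm.
- by rewrite !mxE /= mulr0n oppr0 expr0n.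
- by rewrite !mxE /= mulr0n oppr0 mulr0.
Qed.

End Segment.
Arguments segment_optimal_vertex {R n L a u} x _ _.
Arguments axis_point {R n} s.
Arguments segment_lp {R n} L a u.
Arguments crossing_cut {R n} v r.

(** * The lexicographic priority rule *)

Section Order.
Variables (R : realType) (n : nat).

(** The entries of a cut, right-hand side first. *)
Definition cut_entries (alpha : cut R n) : seqlexi R :=
  [seq alpha 0 j | j <- enum 'I_n.+1].

(** The greater cut is preferred, hence a cut with greater right-hand side. *)
Definition lex_prio : rel (cut R n) := fun alpha beta =>
  (cut_entries beta <= cut_entries alpha)%O.

Lemma lex_prio_rule : priority_rule lex_prio.
Proof.
split=> [alpha beta|alpha beta|beta alpha gamma].
- exact: le_total.
- rewrite /lex_prio => /le_anti /eq_in_map eq_ba; apply/rowP => j.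
  by rewrite eq_ba// mem_enum.
- by rewrite /lex_prio => ba gb; exact: le_trans gb ba.
Qed.

Lemma lex_prio_lt_rhs (alpha beta : cut R n) :
  cut_rhs beta < cut_rhs alpha -> lex_prio alpha beta.
Proof.
move=> lt_ba; rewrite /lex_prio /cut_entries enum_ordSl /= lexi_cons.
by rewrite (ltW lt_ba) leNgt lt_ba.
Qed.

End Order.

(** * The instances and their candidate cuts *)

Section Family.
Variable R : realType.
Implicit Types (lambda q u : R) (t k : nat).

(** Minimise - x_0 subject to -t <= x_0 <= 1/2 and x_1 = x_2 = 0, with x_0 and
    x_2 integer; there are no constraints besides the bounds. *)
Definition instance t : milp R 3 :=
  Milp (Lp (0 : 'M_(0, 3)) 0
          (\col_i (if i == 0 then - t%:R else 0)%:E)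
          (\col_i (if i == 0 then 2^-1 else 0)%:E)
          (- delta_mx 0 0))
       [set i | i != 1].

Lemma instance_segment t :
  segment_lp (relaxation (instance t)) (- t%:R) 2^-1.
Proof.
split=> // x; split=> [[_ bnds]|[s sE ->]].
  exists (x 0 0); first by have := bnds 0; rewrite !mxE eqxx !lee_fin.
  apply/matrixP => i j; rewrite ord1 axis_pointE.
  have := bnds i; rewrite !mxE !lee_fin.
  by case: eqVneq => [->|_]; rewrite ?mulr1 // mulr0 => /le_anti.
split=> [[]//|i]; rewrite !mxE andbT !lee_fin.
by case: eqVneq => _; rewrite ?mulr1// mulr0 lexx.
Qed.

Lemma instance_inj : injective instance.
Proof.
move=> t t' /(congr1 (fun P => lp_lower (relaxation P) 0 0)).
by rewrite !mxE eqxx => -[/oppr_inj /eqP]; rewrite eqr_nat => /eqP.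
Qed.

Lemma integral_axis_point t u :
  integral (instance t) (axis_point u) <-> u \is a Num.int.
Proof.
split=> [/(_ 0)|u_int i _]; first by rewrite inE axis_point0; apply.
by rewrite axis_pointE; case: eqP => _; rewrite ?mulr1 ?mulr0.
Qed.

Lemma int_lt1_le0 (s : R) : s \is a Num.int -> s < 1 -> s <= 0.
Proof. by move=> /intrP[m ->]; rewrite ltrz1 lerz0 -ltzD1 add0r. Qed.

Lemma inv_nat_not_int k : k.+2%:R^-1 \isn't a @Num.int R.
Proof.
apply/negP => /int_lt1_le0; rewrite invf_lt1 ?ltr0n// ltr1n => /(_ isT).
by rewrite leNgt invr_gt0 ltr0n.
Qed.

Lemma instance_feasible t x : milp_feasible (instance t) x ->
  exists2 s, s <= 0 & x = axis_point s.
Proof.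
move=> [/(instance_segment t).2[s /andP[_ s_half] ->]].
move=> /integral_axis_point s_int.
by exists s => //; apply: int_lt1_le0 => //; lra.
Qed.

Lemma instance_solvable t : has_optimal_solution (instance t).
Proof.
exists (axis_point 0).
  split; last by apply/integral_axis_point.
  apply/(instance_segment t).2; exists 0 => //.
  by rewrite oppr_le0 ler0n invr_ge0 ler0n.
move=> y /instance_feasible[s s0 ->].
by rewrite !lp_valueE// !axis_point0 lerN2.
Qed.

Lemma isp_crossing_cut t (a b c r : R) :
  isp (int_vars (instance t)) (crossing_cut [:: a; b; c] r) =
  ((a != 0) + (c != 0))%:R / ((a != 0) + (b != 0) + (c != 0))%:R.
Proof.
have if_nat (B : bool) : (if B then 1 else 0)%N = B by case: B.
rewrite /isp; congr (_%:R / _%:R); rewrite -sum1_card big_mkcond /=.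
  rewrite !big_ord_recl big_ord0 !inE !crossing_cut_coef /=.
  by rewrite !if_nat addn0.
rewrite !big_ord_recl big_ord0 !inE !crossing_cut_coef /=.
by rewrite !if_nat addn0 addnA.
Qed.

Lemma score_crossing_cut t lambda (a b c r : R) :
  0 < a -> a ^+ 2 + b ^+ 2 + c ^+ 2 = 1 ->
  score (instance t) lambda (crossing_cut [:: a; b; c] r) =
  lambda * ((1 + (c != 0))%:R / (1 + (b != 0) + (c != 0))%:R) +
  (1 - lambda) * a.
Proof.
move=> a0 abc; rewrite /score isp_crossing_cut gt_eqF//=.
rewrite obp_crossing_cut ?ltW//.
by rewrite !big_ord_recl big_ord0 /= addr0 addrA.
Qed.

(** The three kinds of cut are named after their integer support: 1/2, 2/3 and
    1.  The low and middle cuts have the same parallelism 3/5, so they tie at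
    lambda = 0; that of the high cut is [q]. *)
Definition low_cut k : cut R 3 := crossing_cut [:: 3 / 5; 4 / 5; 0] k.+3%:R^-1.
Definition mid_cut : cut R 3 := crossing_cut [:: 3 / 5; 12 / 25; 16 / 25] 0.
Definition high_cut q k : cut R 3 :=
  crossing_cut [:: q; 0; Num.sqrt (1 - q ^+ 2)] k.+3%:R^-1.

Lemma score_low_cut t lambda k :
  score (instance t) lambda (low_cut k) =
  lambda * 2^-1 + (1 - lambda) * (3 / 5).
Proof.
rewrite score_crossing_cut; [|lra|by field].
by rewrite eqxx (_ : 4 / 5 != 0) /= ?mul1r//; apply/eqP; lra.
Qed.

Lemma score_mid_cut t lambda :
  score (instance t) lambda mid_cut =
  lambda * (2 / 3) + (1 - lambda) * (3 / 5).
Proof.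
rewrite score_crossing_cut; [|lra|by field].
have b0 : (12 / 25 : R) != 0 by apply/eqP; lra.
have c0 : (16 / 25 : R) != 0 by apply/eqP; lra.
by rewrite b0 c0.
Qed.

Lemma score_high_cut t lambda q k : 0 < q < 1 ->
  score (instance t) lambda (high_cut q k) = lambda + (1 - lambda) * q.
Proof.
move=> /andP[q0 q1]; have q2 : 0 < 1 - q ^+ 2 by nra.
rewrite score_crossing_cut//; last by rewrite sqr_sqrtr ?ltW//; ring.
by rewrite eqxx gt_eqF ?sqrtr_gt0//= divff ?mulr1// pnatr_eq0.
Qed.

(** The cuts presented in the round of index [k], counted from 0. *)
Definition round_cuts q k : {fset cut R 3} :=
  [fset low_cut k; mid_cut; high_cut q k]%fset.

Definition candidates q : presentation R 3 := fun _ H => round_cuts q (size H).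

Definition all_cuts q : set (cut R 3) :=
  [set alpha | exists k, alpha \in round_cuts q k].

Lemma round_cutsP q k alpha : alpha \in round_cuts q k ->
  [\/ alpha = low_cut k, alpha = mid_cut | alpha = high_cut q k].
Proof.
rewrite !inE => /orP[/orP[]|] /eqP ->.
- by constructor 1.
- by constructor 2.
- by constructor 3.
Qed.

Lemma round_cuts_crossing q k alpha : 0 < q -> alpha \in round_cuts q k ->
  exists v r, [/\ 0 < v`_0, alpha = crossing_cut v r &
                  r = 0 \/ r = k.+3%:R^-1].
Proof.
move=> q0 /round_cutsP[] ->.
- by exists [:: 3 / 5; 4 / 5; 0], k.+3%:R^-1; split=> [/=||]; [lra| |right].
- by exists [:: 3 / 5; 12 / 25; 16 / 25], 0; split=> [/=||]; [lra| |left].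
- exists [:: q; 0; Num.sqrt (1 - q ^+ 2)], k.+3%:R^-1.
  by split=> //; right.
Qed.

Lemma round_cuts_valid t q k alpha : 0 < q ->
  alpha \in round_cuts q k -> valid_cut (instance t) alpha.
Proof.
move=> q0 /round_cuts_crossing-/(_ q0)[v [r [v0 -> rE]]] x.
move=> /instance_feasible[s s0 ->].
apply/crossing_cutP => //; apply: le_trans s0 _.
by case: rE => ->; rewrite // invr_ge0 ler0n.
Qed.

Lemma selected_low_cut t q H : 0 < q < 3 / 5 ->
  selected (candidates q) (lex_prio R 3) (instance t) 0 H (low_cut (size H)).
Proof.
move=> /andP[q0 q1]; split=> [|beta /round_cutsP[] ->].
- by rewrite !inE eqxx.
- by right; split=> //; rewrite /lex_prio lexx.
- right; split; first by rewrite score_low_cut score_mid_cut; lra.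
  (* the two scores are equal, but the middle cut has right-hand side 0 *)
  apply: lex_prio_lt_rhs.
  rewrite !crossing_cut_rhs mulr0 mulr_gt0//=; first lra.
  by rewrite invr_gt0 ltr0n.
- by left; rewrite score_low_cut score_high_cut; lra.
Qed.

Lemma selected_mid_cut t q lambda H :
  0 < q < 3 / 5 -> 0 < lambda < 3 / 5 - q -> 3 / 5 - q <= 3^-1 ->
  selected (candidates q) (lex_prio R 3) (instance t) lambda H mid_cut.
Proof.
move=> /andP[q0 q1] /andP[l0 l1] qe; split=> [|beta /round_cutsP[] ->].
- by rewrite !inE eqxx orbT.
- by left; rewrite score_low_cut score_mid_cut; lra.
- by right; split=> //; rewrite /lex_prio lexx.
- by left; rewrite score_mid_cut score_high_cut; [nra|lra].
Qed.

Lemma selected_high_cut t q lambda H :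
  0 < q < 3 / 5 -> 0 < lambda -> 3 / 5 - q <= lambda / 3 ->
  selected (candidates q) (lex_prio R 3) (instance t) lambda H
    (high_cut q (size H)).
Proof.
move=> /andP[q0 q1] l0 ql; split=> [|beta /round_cutsP[] ->].
- by rewrite !inE eqxx orbT.
- by left; rewrite score_low_cut score_high_cut; [nra|lra].
- by left; rewrite score_mid_cut score_high_cut; [nra|lra].
- by right; split=> //; rewrite /lex_prio lexx.
Qed.

(** * Runs of the cutting plane approach *)

Section Run.
Variables (solve : lp_solver R 3) (q : R).
Hypothesis solve_opt : selects_optimal_vertex solve.
Hypothesis q01 : 0 < q.
Let reach := reachable (candidates q) (lex_prio R 3) solve.

Lemma solve_segment {L : lp R 3} {a u} : a <= u -> segment_lp L a u ->
  solve L = axis_point u.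
Proof.
move=> au Lau; apply/(segment_optimal_vertex _ au Lau).
apply: solve_opt; exists (axis_point u).
exact/(segment_optimal_vertex _ au Lau).
Qed.

Lemma lp_after_rcons (P : milp R 3) H alpha :
  lp_after P (rcons H alpha) = add_cut (lp_after P H) alpha.
Proof. exact: foldl_rcons. Qed.

(** A run that has not stopped has only added low and high cuts, so u is still
    1/(k+2); a middle cut makes u = 0, and the run stops there. *)
Lemma reachable_segment t lambda H : reach (instance t) lambda H ->
  exists2 u, u = 0 \/ u = (size H).+2%:R^-1 &
    segment_lp (lp_after (instance t) H) (- t%:R) u.
Proof.
elim=> [|{}H alpha _ [u uE seg] notint [/round_cuts_crossing-/(_ q01) cross _]].
  by exists 2^-1; [right|exact: instance_segment].
have [v [r [v0 -> rE]]] := cross.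
have u0 : 0 <= u by case: uE => ->; rewrite ?invr_ge0 ?ler0n.
have tu : - t%:R <= u by rewrite (le_trans _ u0)// oppr_le0.
exists r; first by rewrite size_rcons.
rewrite lp_after_rcons; apply: (segment_add_cut _ _ _ _ _ _ _ v0 _ seg).
case: uE => uE.
  case: notint; rewrite /lp_point (solve_segment tu seg) uE.
  exact/integral_axis_point.
case: rE => ->; rewrite ?uE ?invr_ge0 ?ler0n//.
by rewrite lef_pV2 ?posrE ?ltr0n// ler_nat.
Qed.

Lemma run_well_defined t lambda :
  well_defined_run (candidates q) (lex_prio R 3) solve
    (all_cuts q) (instance t) lambda.
Proof.
move=> H /reachable_segment[u uE seg].
have u0 : 0 <= u by case: uE => ->; rewrite ?invr_ge0 ?ler0n.
have tu : - t%:R <= u by rewrite (le_trans _ u0)// oppr_le0.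
rewrite /lp_point (solve_segment tu seg); split.
  exact/(segment_optimal_vertex _ tu seg).
move=> notint; case: uE => uE.
  by case: notint; rewrite uE; apply/integral_axis_point.
split=> [|alpha alphaH]; first by exists mid_cut; rewrite !inE eqxx orbT.
split; first by exists (size H).
have [v [r [v0 -> rE]]] := round_cuts_crossing _ _ _ q01 alphaH.
move=> /crossing_cutP-/(_ v0); apply/negP; rewrite -ltNge uE.
case: rE => ->; rewrite ?invr_gt0 ?ltr0n//.
by rewrite ltf_pV2 ?posrE ?ltr0n// ltr_nat.
Qed.

Lemma run_never_stops t lambda v : 0 < v`_0 ->
  (forall H, selected (candidates q) (lex_prio R 3) (instance t) lambda H
     (crossing_cut v (size H).+3%:R^-1)) ->
  never_stops (candidates q) (lex_prio R 3) solve (instance t) lambda.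
Proof.
move=> v0 sel; pose a k : cut R 3 := crossing_cut v k.+3%:R^-1; exists a.
have seg k : segment_lp (lp_after (instance t) (mkseq a k)) (- t%:R) k.+2%:R^-1.
  elim: k => [|k IHk]; first exact: instance_segment.
  rewrite mkseqS lp_after_rcons; apply: segment_add_cut IHk => //.
  by rewrite lef_pV2 ?posrE ?ltr0n// ler_nat.
have notint k :
    ~ integral (instance t) (lp_point solve (instance t) (mkseq a k)).
  rewrite /lp_point (solve_segment _ (seg k)); last first.
    by rewrite (@le_trans _ _ 0)// ?oppr_le0 ?invr_ge0 ler0n.
  by move=> /integral_axis_point; apply/negP/inv_nat_not_int.
move=> k; split=> //; elim: k => [|k IHk]; first exact: reachable_start.
rewrite mkseqS; apply: reachable_round => //.
by have := sel (mkseq a k); rewrite size_mkseq.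
Qed.

Lemma run_solved t lambda :
  selected (candidates q) (lex_prio R 3) (instance t) lambda [::] mid_cut ->
  solved_to_optimality (candidates q) (lex_prio R 3) solve (instance t) lambda.
Proof.
move=> sel; have seg0 := instance_segment t.
exists [:: mid_cut].
  apply: (@reachable_round _ _ _ _ _ _ _ [::]) => //.
    exact: reachable_start.
  rewrite /lp_point (solve_segment _ seg0).
    by move=> /integral_axis_point; apply/negP/inv_nat_not_int.
  by rewrite (@le_trans _ _ 0)// ?oppr_le0 ?invr_ge0 ler0n.
have seg : segment_lp (lp_after (instance t) [:: mid_cut]) (- t%:R) 0.
  by apply: segment_add_cut seg0; rewrite ?invr_ge0 ?ler0n//=; lra.
rewrite /lp_point (solve_segment _ seg) ?oppr_le0 ?ler0n//.
exact/integral_axis_point.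
Qed.

End Run.
End Family.

Theorem theorem3p1 (R : realType) (Lambda : set R)
    (Lambda_fin : finite_set Lambda)
    (Lambda01 : forall lambda, Lambda lambda -> 0 <= lambda <= 1) :
  exists (n : nat) (F : set (milp R n)) (C : set (cut R n))
         (cand : presentation R n) (prio : rel (cut R n)),
    [/\ infinite_set F,
        forall P, F P ->
          has_optimal_solution P /\ lp_obj (relaxation P) != 0,
        infinite_set C,
        forall alpha, C alpha -> family_valid F alpha
      & priority_rule prio] /\
    forall solve : lp_solver R n, selects_optimal_vertex solve ->
      [/\ forall P (lambda : R), F P -> 0 <= lambda <= 1 ->
            well_defined_run cand prio solve C P lambda,
          forall P lambda, F P -> Lambda lambda ->
            never_stops cand prio solve P lambda
        & forall P, F P ->
            infinite_set [set lambda : R |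
              [/\ 0 <= lambda <= 1, ~ Lambda lambda
                & solved_to_optimality cand prio solve P lambda]]].
Proof.
have [d /andP[d0 d1] dP] := finite_pos_lower_bound _ _ Lambda_fin.
pose q : R := 3 / 5 - d / 3.
have q0 : 0 < q by rewrite /q; lra.
have q1 : q < 3 / 5 by rewrite /q; lra.
have q01 : 0 < q < 3 / 5 by rewrite q0.
exists 3, (range (instance R)), (all_cuts R q), (candidates R q),
  (lex_prio R 3).
split; [split|move=> solve solve_opt; split].
- by apply: (infinite_set_inj _ _ (instance_inj R)) => t; exists t.
- move=> _ [t _ <-]; split; first exact: instance_solvable.
  apply/eqP => /matrixP/(_ 0 0)/eqP; rewrite !mxE eqxx oppr_eq0.
  by rewrite oner_eq0.
- apply: (infinite_set_inj _ (high_cut R q)).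
    move=> k k' /(congr1 (@cut_rhs _ _)); rewrite !crossing_cut_rhs /=.
    move=> /(mulfI (lt0r_neq0 q0)) /invr_inj /eqP.
    by rewrite eqr_nat => /eqP[].
  by move=> k; exists k; rewrite !inE eqxx orbT.
- by move=> alpha [k alphaC] _ [t _ <-]; apply: round_cuts_valid alphaC.
- exact: lex_prio_rule.
- by move=> _ lambda [t _ <-] _; exact: run_well_defined.
- move=> _ lambda [t _ <-] Ll; have /andP[l0 _] := Lambda01 _ Ll.
  move: l0; rewrite le_eqVlt => /orP[/eqP <-|l0].
    apply: (run_never_stops _ _ _ solve_opt _ _ [:: 3 / 5; 4 / 5; 0]) => [/=|H].
      lra.
    exact: selected_low_cut.
  have := dP _ Ll l0 => dl.
  pose v := [:: q; 0; Num.sqrt (1 - q ^+ 2)].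
  apply: (run_never_stops _ _ _ solve_opt _ _ v) => //= H.
  by apply: selected_high_cut; rewrite // /q; lra.
- move=> _ [t _ <-].
  pose f k : R := d / 3 / k.+2%:R.
  have f0 k : 0 < f k by rewrite !divr_gt0// ltr0n.
  have fd k : f k < d / 3.
    by rewrite ltr_pdivrMr ?ltr0n// ltr_pMr ?divr_gt0 ?ltr1n.
  apply: (infinite_set_inj _ f) => [k k'|k].
    have d3 : d / 3 != 0 by apply/eqP; lra.
    by rewrite /f => /(mulfI d3) /invr_inj /eqP; rewrite eqr_nat => /eqP[].
  have := f0 k; have := fd k => fk fk0; split; first lra.
    by move=> /dP/(_ fk0); lra.
  by apply: run_solved => //; apply: selected_mid_cut; rewrite // /q; lra.
Qed.
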